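(* Let a proper element $q\in L$ be $2$-potent $\delta_0$-primary. Then $q$ is $\phi$-$\delta$-primary for some function $\phi:L\to L$ with $\phi\leqslant\phi_2$ if and only if $q$ is $\delta$-primary.
   Context: A multiplicative lattice is a complete lattice (least element $0$, greatest element $1$) with a commutative, associative multiplication that distributes over arbitrary joins and for which $1$ is the identity. An element $a$ is compact if $a\leqslant \bigvee X$ with $X\subseteq L$ implies $a\leqslant a_1\vee\dots\vee a_n$ for finitely many $a_i\in X$; $L$ is compactly generated if every element is a join of compact elements. Standing assumptions: $L$ is a compactly generated multiplicative lattice in which $1$ is compact and every finite product of compact elements is compact; $\delta:L\to L$ is an expansion function, i.e. $a\leqslant\delta(a)$ for all $a$, and $a\leqslant b$ implies $\delta(a)\leqslant\delta(b)$. $\delta_0$ is the expansion function $\delta_0(a)=a$. An element $p$ is proper if $p<1$. A proper element $p$ is $\delta$-primary if for all $a,b\in L$, $ab\leqslant p$ implies $a\leqslant p$ or $b\leqslant\delta(p)$. A proper element $p$ is $2$-potent $\delta_0$-primary if for all $a,b\in L$, $ab\leqslant p^2$ implies $a\leqslant p$ or $b\leqslant\delta_0(p)=p$. For $\phi:L\to L$, a proper element $p$ is $\phi$-$\delta$-primary if for all $a,b\in L$, $ab\leqslant p$ and $ab\not\leqslant\phi(p)$ implies $a\leqslant p$ or $b\leqslant\delta(p)$. $\phi_2(a)=a^2$, and $\gamma_1\leqslant\gamma_2$ for functions $L\to L$ means $\gamma_1(a)\leqslant\gamma_2(a)$ for all $a\in L$. *)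

(* Defs.v *)
From HB Require Import structures.
From mathcomp Require Import all_boot all_order.
From mathcomp Require Import boolp classical_sets.

Set Implicit Arguments.
Unset Strict Implicit.
Unset Printing Implicit Defensive.

Import Order.TTheory.
Local Open Scope classical_set_scope.
Local Open Scope order_scope.

HB.mixin Record TBLattice_isComplete (d : Order.disp_t) (L : Type)
    of Order.TBLattice d L := {
  supremums_neq0 : forall X : set L, supremums X !=set0;
  infimums_neq0 : forall X : set L, infimums X !=set0
}.

#[short(type="completeLatticeType")]
HB.structure Definition CompleteLattice (d : Order.disp_t) :=
  { L of Order.TBLattice d L & TBLattice_isComplete d L }.

(* [supremum x0 X] is [x0] when [X] is empty, hence the default [\bot]. *)
Definition bigjoin (d : Order.disp_t) (L : completeLatticeType d)
  (X : set L) : L := supremum \bot X.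

(* [mulm_bigjoin] includes the empty join, i.e. [mulm a \bot = \bot]. *)
HB.mixin Record CompleteLattice_isMultiplicative (d : Order.disp_t) (L : Type)
    of CompleteLattice d L := {
  mulm : L -> L -> L;
  mulmA : associative mulm;
  mulmC : commutative mulm;
  mul1m : left_id \top mulm;
  mulm_bigjoin : forall (a : L) (X : set L),
    mulm a (bigjoin X) = bigjoin (mulm a @` X)
}.

#[short(type="multLatticeType")]
HB.structure Definition MultLattice (d : Order.disp_t) :=
  { L of CompleteLattice d L & CompleteLattice_isMultiplicative d L }.

HB.instance Definition _ (d : Order.disp_t) (L : multLatticeType d) :=
  Monoid.isComLaw.Build L \top mulm mulmA mulmC mul1m.

Declare Scope mult_lattice_scope.
Delimit Scope mult_lattice_scope with ML.
Notation "a * b" := (mulm a b) : mult_lattice_scope.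
Notation "a ^+ n" := (iterop n mulm a \top) : mult_lattice_scope.
Local Open Scope mult_lattice_scope.

Section Definitions.
Context (d : Order.disp_t) (L : multLatticeType d).
Implicit Types (a b p : L) (delta phi : L -> L).

Definition compact_elt a := forall X : set L,
  a <= bigjoin X ->
  exists2 s : seq L, (forall x, x \in s -> X x) & a <= \join_(x <- s) x.

Definition compactly_generated := forall a,
  exists2 X : set L, X `<=` [set x | compact_elt x] & a = bigjoin X.

Definition compact_prod_closed := forall s : seq L,
  (forall x, x \in s -> compact_elt x) ->
  compact_elt (\big[mulm / \top]_(x <- s) x).

Definition expansion delta :=
  (forall a, a <= delta a) /\ (forall a b, a <= b -> delta a <= delta b).

Definition proper_elt p := p < \top.

Definition delta0 : L -> L := id.

Definition phi2 : L -> L := fun a => a ^+ 2.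

Definition primary delta p := proper_elt p /\
  forall a b, a * b <= p -> a <= p \/ b <= delta p.

Definition two_potent_primary delta p := proper_elt p /\
  forall a b, a * b <= p ^+ 2 -> a <= p \/ b <= delta p.

Definition phi_primary phi delta p := proper_elt p /\
  forall a b, a * b <= p -> ~~ (a * b <= phi p) -> a <= p \/ b <= delta p.

End Definitions.

Arguments compactly_generated {d} L.
Arguments compact_prod_closed {d} L.
Arguments delta0 {d L}.
Arguments phi2 {d L}.

(* Main.v *)
Require Import Defs.
From mathcomp Require Import all_boot all_order.
From mathcomp Require Import boolp classical_sets.

(** A product [a * b <= q] that escapes [phi q] is handled by the
    [phi]-[delta]-primary hypothesis.  One that does not escape lies below
    [q ^+ 2], because [phi <= phi2]; there 2-potency gives [a <= q] or
    [b <= q], and [q <= delta q].  Conversely, a [delta]-primary element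
    satisfies the [phi]-[delta]-primary condition for every [phi], so
    [phi2] itself is a witness. *)

Theorem theorem2p25 (d : Order.disp_t) (L : multLatticeType d)
    (L_gen : compactly_generated L)
    (top_compact : compact_elt (\top%O : L))
    (prod_compact : compact_prod_closed L)
    (delta : L -> L) (delta_exp : expansion delta)
    (q : L) (q_proper : proper_elt q)
    (q_potent : two_potent_primary delta0 q) :
  (exists2 phi : L -> L, (phi <= phi2)%O & phi_primary phi delta q)
  <-> primary delta q.
Proof.
split=> [[phi phi_le [_ q_phi]] | [_ q_prim]].
  split=> // a b ab_q.
  have [ab_phi | ab_nphi] := boolP (mulm a b <= phi q)%O; last exact: q_phi.
  have [_ q_pot] := q_potent; have [delta_ge _] := delta_exp.
  have ab_q2 : (mulm a b <= phi2 q)%O.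
    by apply: Order.POrderTheory.le_trans ab_phi _; move/lefP: phi_le; apply.
  have [a_q | b_q] := q_pot a b ab_q2; first by left.
  by right; apply: Order.POrderTheory.le_trans b_q (delta_ge q).
exists phi2; first exact: Order.POrderTheory.lexx.
by split=> // a b ab_q _; apply: q_prim.
Qed.
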